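(* Let $n=2^{k_0}+2^{k_1}+\cdots+2^{k_m}$ with integers $0\le k_0<k_1<\cdots<k_m$ and $m\ge 0$. Any minimal set of generators of a Sylow 2-subgroup of the alternating group $A_n$ has $\left(\sum_{i=0}^{m}k_i\right)-1$ generators if $m>0$, and it has $k_0$ generators if $m=0$.
   Context: A minimal set of generators means a generating set of smallest possible cardinality (the rank of the group).
   Formalization: The cases n = 2 and n = 2^e + 1 with e ≥ 2 are excluded, since the claim is false there: A_2 is trivial (0 generators, not 1), and for n = 2^e + 1 a Sylow 2-subgroup of A_n is one of A_{2^e}, which needs e generators, not e − 1. *)

(* Defs.v *)
From mathcomp Require Import all_boot all_fingroup all_solvable.

Set Implicit Arguments.
Unset Strict Implicit.
Unset Printing Implicit Defensive.

(* "Minimal" is meant for cardinality, not for inclusion: 'm(G) is the smallest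
   cardinality of a generating set of G. *)
Definition minimal_genset (gT : finGroupType) (G S : {set gT}) : Prop :=
  (<<S>> = G /\ #|S| = 'm(G))%g.

Lemma minimal_gensetP (gT : finGroupType) (G : {group gT}) (S : {set gT}) :
  minimal_genset G S <->
  (<<S>> = G)%g /\ (forall T : {set gT}, (<<T>> = G)%g -> #|S| <= #|T|).
Proof.
split=> [[genS cardS] | [genS minS]]; split=> //.
  by move=> T genT; rewrite cardS -genT grank_min.
have [B genB cardB] := grank_witness G.
by apply/eqP; rewrite eqn_leq -{1}cardB minS //= -genS grank_min.
Qed.

(* Main.v *)
Require Import Defs.
From mathcomp Require Import all_boot all_fingroup all_solvable.

(** By the Burnside basis theorem the rank of a 2-group [G] is the base 2
logarithm of [#|G : 'Phi(G)|] ([grank_Phi]), so the theorem is a computation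
of Frattini indices.

A Sylow 2-subgroup of [S_n] can be built by hand.  On a block of [2 ^ k] points
it is an iterated wreath product: halve the block, take the group [Q] already
built on one half and an involution [t] exchanging the halves, and form
[(Q * Q ^ t) <t>].  For general [n], take the product of these groups over
disjoint blocks of sizes [2 ^ k_0], ..., [2 ^ k_m].  The order is the 2-part of
[n!], since the 2-adic valuation of [(2 ^ k_0 + ... + 2 ^ k_m)!] is
the sum of the [2 ^ k_i - 1] ([logn2_fact_sum]).  A Sylow 2-subgroup of [A_n] is
then, up to conjugacy, the subgroup [P] of even elements of this group [G]
([grank_Sylow_Alt]).

Two facts determine the Frattini indices.

- If a 2-group is generated by a normal subgroup [B] of index 2 and an
  involution [t] outside [B], and [V = B / 'Phi(B)], its Frattini index is
  [2 * #|'C_V(t)|]: modulo ['Phi(B)] the Frattini subgroup is [[V, t]], of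
  order [#|V : 'C_V(t)|] ([index_Phi_abelem_ext]).  For the wreath product
  the fixed points of [t] on [V] are the classes of the diagonal elements
  [q * q ^ t], so that the rank of [Q] increases by one ([index_Phi_wreath]).
  The diagonal elements are even, so the same count applies to the even part of
  the wreath product as soon as ['Phi(B)] does not change when [B] is replaced
  by its even part.  This is why one block of size at least 4 gives [k_0] both
  in the symmetric and in the alternating group.

- If [G] is a central product of [A] and [B], each containing an odd involution,
  the even part [P] of [G] has the same Frattini subgroup as [G]
  ([Phi_index2_cprod]): the square of an odd element of [A] is also the square
  of its product with an odd involution of [B], and that product is even.
  With two blocks of size at least 2 the rank thus drops by exactly one from
  [S_n] to [A_n].  The same fact, applied to [Q * Q ^ t], supplies what the
  previous point requires. *)

Set Implicit Arguments.
Unset Strict Implicit.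
Unset Printing Implicit Defensive.
Local Open Scope group_scope.

(** * Frattini subgroups of 2-groups *)

Section Frattini.
Variable gT : finGroupType.
Implicit Types (A B G H M P : {group gT}) (t x y : gT).

(** Burnside basis theorem: representatives of a generating set of the
elementary abelian group [G / 'Phi(G)] generate [G], because ['Phi(G)] consists
of non-generators. *)
Lemma grank_Phi (p : nat) G : p.-group G -> 'm(G) = logn p #|G : 'Phi(G)|.
Proof.
move=> pG; have nPhi := normal_norm (Phi_normal G).
have abG := Phi_quotient_abelem pG.
rewrite -card_quotient // -(rank_abelem abG) -(grank_abelian (abelem_abelian abG)).
apply/eqP; rewrite eqn_leq quotient_grank // andbT.
have [B genB <-] := grank_witness (G / 'Phi(G)).
have sBG: B \subset G / 'Phi(G) by rewrite -genB subset_gen.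
pose X := [set repr (y : coset_of 'Phi(G)) | y in B].
have sXG: X \subset G.
  apply/subsetP=> _ /imsetP[y By ->].
  have /morphimP[x Nx Gx ->] := subsetP sBG _ By.
  rewrite /= val_coset //.
  have := mem_repr_rcoset [group of 'Phi(G)] x => /rcosetP[z Pz ->].
  by rewrite groupM // (subsetP (Phi_sub G)).
have defB: B = X / 'Phi(G).
  apply/setP=> y; apply/idP/idP=> [By | /morphimP[x Nx /imsetP[z Bz ->] ->]].
    rewrite -(coset_reprK y); apply: mem_morphim; rewrite ?repr_coset_norm //.
    exact: imset_f.
  by rewrite /= coset_reprK.
have genX: <<X>> = G.
  apply: Phi_nongen; apply/eqP; rewrite -joing_idr eqEsubset join_subG Phi_sub.
  rewrite gen_subG sXG /= -(quotientSGK nPhi) ?joing_subl //=.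
  rewrite quotientYidl ?gen_subG ?(subset_trans sXG) //.
  by rewrite quotient_gen ?(subset_trans sXG) // -defB genB.
rewrite -{1}genX (leq_trans (grank_min X)) // leq_imset_card //.
Qed.

(** The quotient of [G] by its subgroup of squares has exponent 2, hence is
elementary abelian. *)
Lemma Phi_sub_squares G H :
  2.-group G -> {in G, forall x, x ^+ 2 \in H} -> 'Phi(G) \subset H.
Proof.
move=> pG sqH; apply: subset_trans (_ : 'Mho^1(G) \subset H); last first.
  by rewrite (MhoE 1 pG) gen_subG; apply/subsetP=> _ /imsetP[x Gx ->]; apply: sqH.
apply: (Phi_min pG (gFnorm _ G)); apply: exponent2_abelem; apply/exponentP.
move=> _ /morphimP[x Nx Gx ->]; rewrite -morphX //; apply: coset_id.
by rewrite (Mho_p_elt 1) // (mem_p_elt pG).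
Qed.

Lemma mulg_index2 G M x y :
  M \subset G -> #|G : M| = 2 -> x \in G :\: M -> y \in G :\: M -> x * y \in M.
Proof.
move=> sMG iM GMx GMy; have := GMx; rewrite -(rcoset_index2 sMG iM (x := y^-1)).
  by rewrite mem_rcoset invgK.
by move: GMy; rewrite !inE !groupV.
Qed.

(** Squares of elements of [A] outside [P] are squares of elements of [P]:
multiply by [b], which commutes with [A], squares to 1 and is outside [P] too.
The same holds for [B], with [a]. *)
Lemma Phi_index2_cprod G A B P a b :
    2.-group G -> A * B = G -> B \subset 'C(A) ->
    P \subset G -> #|G : P| = 2 ->
    a \in A -> a ^+ 2 = 1 -> a \notin P -> b \in B -> b ^+ 2 = 1 -> b \notin P ->
  'Phi(P) = 'Phi(G).
Proof.
move=> pG defG cAB sPG iP Aa a2 aP Bb b2 bP; apply/eqP; rewrite eqEsubset (PhiS pG) //=.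
have [sAG sBG]: A \subset G /\ B \subset G.
  by rewrite -defG mulG_subl mulG_subr.
(* [c] serves to push [x] into [P] without changing its square. *)
have sqP x c : x \in G -> c \in G -> commute x c -> c ^+ 2 = 1 -> c \notin P ->
    x ^+ 2 \in 'Phi(P).
  move=> Gx Gc cxc c2 cP.
  have sq y: y \in P -> y ^+ 2 \in 'Phi(P).
    move=> Py; rewrite (Phi_joing (pgroupS sPG pG)); apply: (subsetP (joing_subr _ _)).
    by rewrite (MhoE 1 (pgroupS sPG pG)) mem_gen //; apply/imsetP; exists y.
  have [Px | nPx] := boolP (x \in P); first exact: sq.
  rewrite -[x ^+ 2]mulg1 -c2 -expgMn //; apply: sq.
  by apply: (mulg_index2 sPG iP); rewrite inE ?nPx ?cP.
rewrite -defG (Phi_mulg (pgroupS sAG pG) (pgroupS sBG pG) cAB) mul_subG //.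
  apply: Phi_sub_squares (pgroupS sAG pG) _ => x Ax.
  apply: (sqP x b (subsetP sAG x Ax) (subsetP sBG b Bb)) => //.
  by apply: commute_sym; apply: (centsP cAB).
apply: Phi_sub_squares (pgroupS sBG pG) _ => x Bx.
apply: (sqP x a (subsetP sBG x Bx) (subsetP sAG a Aa)) => //.
exact: (centsP cAB).
Qed.

(** The map [x |-> [~ x, t]] is an endomorphism of the abelian group [B], with
kernel ['C_B[t]].  Its image is ['Phi(G)]: for [x] outside [B] the square
[x ^+ 2] is the commutator [[~ x * t, t]]. *)
Lemma index_Phi_abelem_ext G B t :
    2.-group G -> B \subset G -> #|G : B| = 2 -> 2.-abelem B ->
    t \in G -> t \notin B -> t ^+ 2 = 1 ->
  #|G : 'Phi(G)| = (2 * #|'C_B[t]|)%N.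
Proof.
move=> pG sBG iB abB Gt nBt t2; have /abelemP := abB => -[] // cBB expB.
have nBG := normal_norm (index2_normal sBG iB).
have fB x : x \in B -> [~ x, t] \in B.
  by move=> Bx; rewrite groupM ?groupV // memJ_norm // (subsetP nBG).
have fM : {in B &, {morph (fun x => [~ x, t]) : x y / x * y}}.
  move=> x y Bx By; rewrite /= commMgJ conjgE.
  by rewrite ((centsP cBB) [~ x, t] (fB x Bx) y By) mulKg.
pose f := Morphism fM.
have kerf: 'ker f = 'C_B[t].
  apply/setP=> x; rewrite inE [in RHS]inE; apply: andb_id2l => Bx.
  by rewrite 2!inE; apply/commgP/cent1P.
suffices defPhi: 'Phi(G) = f @* B.
  have cB : (#|f @* B| * #|'C_B[t]|)%N = #|B|.
    by rewrite card_morphim setIid kerf mulnC Lagrange ?subsetIl.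
  have cPhi : #|'Phi(G)| = #|f @* B| by rewrite defPhi.
  apply/eqP; rewrite -(eqn_pmul2l (cardG_gt0 [group of 'Phi(G)])) Lagrange ?Phi_sub //.
  by rewrite -(Lagrange sBG) iB -cB cPhi mulnC mulnCA mulnA.
apply/eqP; rewrite eqEsubset; apply/andP; split; last first.
  rewrite (Phi_joing pG); apply: subset_trans (joing_subl _ _).
  apply/subsetP=> _ /morphimP[x _ Bx ->]; apply: mem_commg => //.
  exact: (subsetP sBG).
apply: Phi_sub_squares pG _ => x Gx.
have [Bx | nBx] := boolP (x \in B); first by rewrite expB.
have tt : t * t = 1 := t2.
have tV : t^-1 = t by apply/eqP; rewrite eq_invg_mul tt.
have Bxt : x * t \in B by apply: (mulg_index2 sBG iB); rewrite inE ?nBx ?nBt.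
have xtV : (x * t)^-1 = x * t by apply/eqP; rewrite eq_invg_mul; apply/eqP/(expB _ Bxt).
apply/morphimP; exists (x * t) => //.
by rewrite /f /= /commg conjgE xtV tV -!mulgA tt mulg1 (mulgA t) tt mul1g.
Qed.

End Frattini.

Section Wreath.
Variable gT : finGroupType.
Implicit Types (B G Q : {group gT}) (t : gT).

(** Here [G] is [B <t>], where [B] lies in [Q * Q :^ t] and contains the
diagonal elements [q * q ^ t].  Modulo ['Phi(B)] the elements of [B] fixed by
[t] are exactly the diagonal ones, and they form a copy of [Q / 'Phi(Q)].  The
group [B] is allowed to be smaller than [Q * Q :^ t] so that the count also
covers the even part of a wreath product of permutation groups. *)
Lemma index_Phi_wreath Q G B t :
    2.-group G -> B \subset G -> #|G : B| = 2 ->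
    t \in G -> t \notin B -> t ^+ 2 = 1 ->
    Q :^ t \subset 'C(Q) -> Q :&: Q :^ t = 1 -> B \subset Q * Q :^ t ->
    {in Q, forall q, q * q ^ t \in B} -> 'Phi(B) = 'Phi(Q) * 'Phi(Q :^ t) ->
  #|G : 'Phi(G)| = (2 * #|Q : 'Phi(Q)|)%N.
Proof.
move=> pG sBG iB Gt nBt t2 cQQt tiQ sBQ diagB PhiB.
have pB := pgroupS sBG pG; have nBG := index2_normal sBG iB.
have nPhi : G \subset 'N('Phi(B)).
  exact: normal_norm (char_normal_trans (Phi_char B) nBG).
have cc q r : q \in Q -> r \in Q -> commute q (r ^ t).
  by move=> Qq Qr; apply: commute_sym; apply: (centsP cQQt); rewrite ?memJ_conjg.
have Nqt q : q \in Q -> q * q ^ t \in 'N('Phi(B)).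
  by move=> Qq; rewrite (subsetP nPhi) // (subsetP sBG) ?diagB.
have gM : {in Q &, {morph (fun q => coset 'Phi(B) (q * q ^ t)) : x y / x * y}}.
  move=> x y Qx Qy /=; rewrite -morphM ?Nqt //; congr (coset _ _).
  move: (cc y x Qy Qx); rewrite conjMg; move: (x ^ t) (y ^ t) => u v cyu.
  by rewrite -!mulgA (mulgA y) cyu !mulgA.
(* [g] sends [q] to the class of the diagonal element of [q]. *)
pose g := Morphism gM.
have tj x : (x ^ t) ^ t = x by rewrite -conjgM (t2 : t * t = 1) conjg1.
(* The factors of an element of ['Phi(Q) * 'Phi(Q :^ t)] are unique, as [Q]
   and [Q :^ t] intersect trivially. *)
have uniq q r : q \in Q -> r \in Q -> q * r ^ t \in 'Phi(B) ->
    (q \in 'Phi(Q)) && (r \in 'Phi(Q)).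
  move=> Qq Qr; rewrite PhiB PhiJ => /mulsgP[u w' Pu /imsetP[w Pw ->] e].
  have [Qu Qw] : u \in Q /\ w \in Q by rewrite !(subsetP (Phi_sub Q)).
  have: u^-1 * q = (w * r^-1) ^ t.
    rewrite conjMg conjVg; apply: (mulIg (r ^ t)).
    by rewrite -!mulgA e mulKg mulVg mulg1.
  move=> e1; have: u^-1 * q \in Q :&: Q :^ t.
    by rewrite inE groupM ?groupV //= e1 memJ_conjg groupM ?groupV.
  rewrite tiQ => /set1P e2; move/esym: e1; rewrite e2 => /eqP.
  rewrite conjg_eq1 -eq_mulgV1 => /eqP <-; rewrite Pw andbT.
  by move/eqP: e2; rewrite -eq_mulVg1 => /eqP <-.
have kerg : 'ker g = 'Phi(Q).
  apply/setP=> q; rewrite 2!inE.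
  apply/andP/idP=> [[Qq] | Pq].
    rewrite inE => /eqP /= /coset_idr H; have /H : q * q ^ t \in 'N('Phi(B)).
      exact: Nqt.
    by case/(uniq q q Qq Qq)/andP.
  have Qq := subsetP (Phi_sub Q) q Pq; split=> //; rewrite inE /=; apply/eqP.
  by apply: coset_id; rewrite PhiB mem_mulg // PhiJ memJ_conjg.
suffices defC : 'C_(B / 'Phi(B))[coset 'Phi(B) t] = g @* Q.
  have Nt : t \in 'N('Phi(B)) := subsetP nPhi t Gt.
  rewrite -(index_quotient_eq (K := 'Phi(G)) (H := 'Phi(B))) ?Phi_sub //; last first.
    by rewrite (subset_trans (subsetIr _ _)) // (PhiS pG).
  rewrite (quotient_Phi pG nPhi).
  have tB : coset 'Phi(B) t \notin B / 'Phi(B).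
    apply: contra nBt => tB; rewrite -(quotientGK (Phi_normal B)).
    by rewrite mem_morphpre.
  rewrite (index_Phi_abelem_ext (B := (B / 'Phi(B))%G) (t := coset 'Phi(B) t)) //.
  - by congr (_ * _)%N; rewrite defC card_morphim setIid kerg.
  - exact: quotient_pgroup.
  - exact: quotientS.
  - by rewrite index_quotient_eq // (subset_trans (subsetIr _ _)) // Phi_sub.
  - exact: Phi_quotient_abelem pB.
  - exact: mem_quotient.
  by rewrite -morphX // t2 morph1.
have Nt : t \in 'N('Phi(B)) := subsetP nPhi t Gt.
apply/eqP; rewrite eqEsubset; apply/andP; split; apply/subsetP; last first.
  move=> _ /morphimP[q _ Qq ->]; rewrite inE mem_quotient ?diagB //=.
  apply/cent1P; rewrite /commute -!morphM ?Nqt //; congr (coset _ _).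
  have := cc q q Qq Qq; rewrite /commute => cqt.
  by rewrite [LHS]conjgC conjMg tj -cqt.
move=> v /setIP[/morphimP[x Nx Bx ->{v}] /cent1P cxt].
have /mulsgP[a _ Qa /imsetP[b Qb ->] defx] := subsetP sBQ x Bx.
have Qd : a^-1 * b \in Q by rewrite groupM ?groupV.
have Qd' : b^-1 * a \in Q by rewrite groupM ?groupV.
have dP : x^-1 * x ^ t \in 'Phi(B).
  apply: coset_idr; first by rewrite groupM ?groupV // groupJ.
  rewrite morphM ?groupV ?morphV ?morphJ ?groupJ //=.
  by rewrite (conjg_fixP _) ?mulVg //; apply/commgP.
(* For [x = a * b ^ t] fixed by [t] modulo ['Phi(B)], this commutator shows that
   [a] and [b] agree modulo ['Phi(Q)], so [x] is diagonal modulo ['Phi(B)]. *)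
have dE : x^-1 * x ^ t = (a^-1 * b) * (b^-1 * a) ^ t.
  have cba := cc b a Qb Qa; have cdb := cc _ _ Qd (groupVr Qb).
  rewrite defx (conjMg a) tj -cba invMg -conjVg (conjMg _ a) [RHS]mulgA cdb.
  by move: (b^-1 ^ t) (a ^ t) => u v; rewrite !mulgA.
have [Pd _] : a^-1 * b \in 'Phi(Q) /\ b^-1 * a \in 'Phi(Q).
  by apply/andP; apply: uniq; rewrite // -dE.
have Pdt : (a^-1 * b) ^ t \in 'Phi(B).
  by rewrite PhiB -[_ ^ t]mul1g mem_mulg // PhiJ memJ_conjg.
apply/morphimP; exists a => //=.
have -> : x = (a * a ^ t) * (a^-1 * b) ^ t.
  by rewrite defx -[RHS]mulgA -conjMg mulKVg.
by rewrite coset_kerr.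
Qed.

End Wreath.

(** * Sylow 2-subgroups built from blocks *)

Section Permutations.
Variable T : finType.
Implicit Types (D : {set T}) (G Q : {group {perm T}}) (s t : {perm T}).

(** The product of [n] disjoint transpositions matching the two sets; its sign
is the parity of [n]. *)
Lemma swap_involution n D1 D2 :
    #|D1| = n -> #|D2| = n -> [disjoint D1 & D2] ->
  exists t, [/\ t ^+ 2 = 1, perm_on (D1 :|: D2) t,
                {in D1, forall x, t x \in D2} & odd_perm t = odd n].
Proof.
elim: n D1 D2 => [|n IHn] D1 D2 cD1 cD2 dD.
  exists 1; rewrite expg1n perm_on1 odd_perm1; split=> // x.
  by rewrite (cards0_eq cD1) inE.
have [x D1x] : exists x, x \in D1 by apply/card_gt0P; rewrite cD1.
have [y D2y] : exists y, y \in D2 by apply/card_gt0P; rewrite cD2.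
have D2x : x \notin D2 by rewrite (disjointFr dD).
have D1y : y \notin D1 by rewrite (disjointFl dD).
have xy : x != y by apply: contraNneq D2x => ->.
have [|||t [t2 tD tD12 ot]] := IHn (D1 :\ x) (D2 :\ y).
- by apply/eqP; rewrite -eqSS -cD1 (cardsD1 x D1) D1x.
- by apply/eqP; rewrite -eqSS -cD2 (cardsD1 y D2) D2y.
- by apply: disjointWl (subsetDl _ _) (disjointWr (subsetDl _ _) dD).
have cxyt : commute (tperm x y) t.
  apply: (perm_onC (tperm_on x y) tD).
  rewrite disjoint_sym disjoints_subset; apply/subsetP=> z; rewrite !inE.
  case/orP=> /andP[nz Dz]; rewrite negb_or nz ?andbT /=.
    by apply: contraNneq D1y => <-.
  by apply: contraNneq D2x => <-.
have sxy : [set x; y] \subset D1 :|: D2.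
  by apply/subsetP=> z; rewrite !inE => /orP[] /eqP->; rewrite ?D1x ?D2y ?orbT.
exists (tperm x y * t); split.
- by rewrite expgMn // t2 mulg1 expgS expg1 tperm2.
- apply: perm_onM; first exact: subset_trans (tperm_on x y) sxy.
  by apply: subset_trans tD _; apply: setUSS; apply: subsetDl.
- move=> z D1z; rewrite permM; have [-> | zx] := eqVneq z x.
    by rewrite tpermL (out_perm tD) // !inE eqxx (negPf D1y) andbF.
  rewrite tpermD 1?eq_sym //; last by apply: contraNneq D1y => <-.
  by have := tD12 z; rewrite !inE zx D1z => /(_ isT)/andP[].
by rewrite odd_mul_tperm xy ot.
Qed.

Lemma Sym_disjoint_TI D1 D2 G1 G2 :
    [disjoint D1 & D2] -> G1 \subset perm.Sym D1 -> G2 \subset perm.Sym D2 ->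
  G1 :&: G2 = 1.
Proof.
move=> dD /subsetP sG1 /subsetP sG2; apply/trivgP/subsetP=> s /setIP[G1s G2s].
rewrite inE; apply/eqP/(@perm_on_id _ _ (D1 :&: D2)).
  have := sG1 _ G1s; have := sG2 _ G2s; rewrite !inE => /subsetP on2 /subsetP on1.
  by apply/subsetP=> x sx; rewrite inE on1 ?on2.
by rewrite (disjoint_setI0 dD) cards0.
Qed.

Lemma Sym_disjoint_cent D1 D2 G1 G2 :
    [disjoint D1 & D2] -> G1 \subset perm.Sym D1 -> G2 \subset perm.Sym D2 ->
  G2 \subset 'C(G1).
Proof.
move=> dD /subsetP sG1 /subsetP sG2; apply/centsP=> s2 G2s s1 G1s.
apply: commute_sym; apply: (@perm_onC _ D1 D2) => //.
  by have := sG1 _ G1s; rewrite inE.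
by have := sG2 _ G2s; rewrite inE.
Qed.

Lemma index_setI_Alt G s :
  s \in G -> odd_perm s -> #|G : G :&: 'Alt_T| = 2.
Proof.
move=> Gs os; have defD : G :\: 'Alt_T = (G :&: 'Alt_T) :* s.
  apply/setP=> x; rewrite mem_rcoset in_setD Alt_even in_setI Alt_even.
  rewrite odd_permM odd_permV os groupMr ?groupV //.
  by case: (x \in G); case: (odd_perm x).
apply/eqP; rewrite -(eqn_pmul2l (cardG_gt0 (G :&: 'Alt_T))) Lagrange ?subsetIl //.
by rewrite -(cardsID 'Alt_T G) defD card_rcoset muln2 addnn.
Qed.

(** What [Phi_index2_cprod] requires of each factor when the subgroup of index 2
is the set of even permutations. *)
Definition odd_involution_in G := exists2 s, s \in G & s ^+ 2 = 1 /\ odd_perm s.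

(** For such a group [r] is the rank; recording the Frattini index instead makes
products and wreath products a matter of counting. *)
Definition two_group_on D G a r :=
  [/\ G \subset perm.Sym D, #|G| = (2 ^ a)%N & #|G : 'Phi(G)| = (2 ^ r)%N].

Lemma two_group_on_pgroup D G a r : two_group_on D G a r -> 2.-group G.
Proof. by case=> _ cG _; rewrite /pgroup cG pnatX. Qed.

Lemma two_group_on_cprod D1 D2 G1 G2 a1 a2 r1 r2 :
    [disjoint D1 & D2] -> two_group_on D1 G1 a1 r1 -> two_group_on D2 G2 a2 r2 ->
  two_group_on (D1 :|: D2) (G1 <*> G2) (a1 + a2) (r1 + r2).
Proof.
move=> dD tG1 tG2; have [pG1 pG2] := (two_group_on_pgroup tG1, two_group_on_pgroup tG2).
have [[sG1 cG1 iG1] [sG2 cG2 iG2]] := (tG1, tG2).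
have cG := Sym_disjoint_cent dD sG1 sG2; have tiG := Sym_disjoint_TI dD sG1 sG2.
have defG := cent_joinEr cG.
have cGP : #|G1 <*> G2| = (#|G1| * #|G2|)%N by rewrite defG TI_cardMg.
split.
- rewrite join_subG; apply/andP; split.
    apply: subset_trans sG1 _; apply/subsetP=> s; rewrite !inE.
    by move/subset_trans; apply; apply: subsetUl.
  apply: subset_trans sG2 _; apply/subsetP=> s; rewrite !inE.
  by move/subset_trans; apply; apply: subsetUr.
- by rewrite cGP cG1 cG2 expnD.
have tiPhi : 'Phi(G1) :&: 'Phi(G2) = 1.
  by apply/trivgP; rewrite -tiG setISS ?Phi_sub.
rewrite -divgS ?Phi_sub //= cGP defG (Phi_mulg pG1 pG2 cG) TI_cardMg //.
rewrite -(Lagrange (Phi_sub G1)) -(Lagrange (Phi_sub G2)) iG1 iG2 mulnACA -expnD.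
by rewrite mulKn // muln_gt0 !cardG_gt0.
Qed.

Lemma Phi_setI_Alt_cprod D1 D2 G1 G2 a1 a2 r1 r2 :
    [disjoint D1 & D2] -> two_group_on D1 G1 a1 r1 -> two_group_on D2 G2 a2 r2 ->
    odd_involution_in G1 -> odd_involution_in G2 ->
  'Phi((G1 <*> G2) :&: 'Alt_T) = 'Phi(G1 <*> G2).
Proof.
move=> dD tG1 tG2 [s1 G1s [s12 os1]] [s2 G2s [s22 os2]].
have [[sG1 _ _] [sG2 _ _]] := (tG1, tG2).
have cG := Sym_disjoint_cent dD sG1 sG2.
have Gs1 : s1 \in G1 <*> G2 by rewrite (subsetP (joing_subl _ _)).
have Gs2 : s2 \in G1 <*> G2 by rewrite (subsetP (joing_subr _ _)).
apply: (Phi_index2_cprod (A := G1) (B := G2) (a := s1) (b := s2)) => //=.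
- exact: two_group_on_pgroup (two_group_on_cprod dD tG1 tG2).
- by rewrite cent_joinEr.
- exact: subsetIl.
- exact: index_setI_Alt Gs1 os1.
- by rewrite inE Alt_even os1 andbF.
by rewrite inE Alt_even os2 andbF.
Qed.

Lemma set_split a b D :
    #|D| = (a + b)%N ->
  exists D1 D2 : {set T},
    [/\ [disjoint D1 & D2], D1 :|: D2 = D, #|D1| = a & #|D2| = b].
Proof.
move=> cD; have: 0 < #|[set D1 : {set T} | D1 \subset D & #|D1| == a]|.
  by rewrite cards_draws bin_gt0 cD leq_addr.
case/card_gt0P=> D1; rewrite inE => /andP[sD1 /eqP cD1].
exists D1, (D :\: D1); rewrite cardsD (setIidPr sD1) cD cD1.
rewrite addKn; split=> //.
  by rewrite disjoint_sym disjoints_subset subsetDr.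
by rewrite -[RHS](setID D D1) (setIidPr sD1).
Qed.

(** Halving the group while keeping its Frattini subgroup lowers the rank by
one. *)
Lemma index_Phi_setI_Alt_cprod D1 D2 G1 G2 a1 a2 r1 r2 :
    [disjoint D1 & D2] -> two_group_on D1 G1 a1 r1 -> two_group_on D2 G2 a2 r2 ->
    odd_involution_in G1 -> odd_involution_in G2 ->
  #|(G1 <*> G2) :&: 'Alt_T : 'Phi((G1 <*> G2) :&: 'Alt_T)| = (2 ^ (r1 + r2 - 1))%N.
Proof.
move=> dD tG1 tG2 inv1 inv2; set G := (G1 <*> G2)%G.
have PhiE : 'Phi(G :&: 'Alt_T) = 'Phi(G) := Phi_setI_Alt_cprod dD tG1 tG2 inv1 inv2.
have [_ _ iG] := two_group_on_cprod dD tG1 tG2.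
have [s G1s [_ os]] := inv1.
have iA : #|G : G :&: 'Alt_T| = 2.
  exact: index_setI_Alt (subsetP (joing_subl _ _) s G1s) os.
have sPhi : 'Phi(G) \subset G :&: 'Alt_T by rewrite -PhiE Phi_sub.
rewrite -/G PhiE; have := Lagrange_index (subsetIl G 'Alt_T) sPhi.
rewrite iA iG; case: (r1 + r2)%N => [|r].
  by move/(congr1 odd); rewrite mul2n odd_double.
by rewrite subn1 expnS => /eqP; rewrite eqn_pmul2l // => /eqP.
Qed.

(** By induction on [k], with [G] the wreath product of the group of one half by
an involution [t] exchanging the halves.  For [k > 1] the halves have even size,
so [t] is even and the even part of [G] is the even part of [Q * Q :^ t]
extended by [t].  For [k = 1] the involution [t] itself is odd, and the even part
is trivial: hence the condition [1 < k]. *)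
Lemma exists_block k D :
    #|D| = (2 ^ k)%N ->
  exists G : {group {perm T}},
    [/\ two_group_on D G (2 ^ k - 1) k,
        0 < k -> odd_involution_in G
      & 1 < k -> #|G :&: 'Alt_T : 'Phi(G :&: 'Alt_T)| = (2 ^ k)%N].
Proof.
elim: k D => [|k IHk] D cD.
  exists 1%G; split=> //; split; rewrite ?sub1G ?cards1 //.
  by rewrite (trivgP (Phi_sub 1%G)) indexgg.
have [D1 [D2 [dD defD cD1 cD2]]] : exists D1 D2 : {set T},
    [/\ [disjoint D1 & D2], D1 :|: D2 = D, #|D1| = 2 ^ k & #|D2| = 2 ^ k]%N.
  by apply: set_split; rewrite cD expnS mul2n addnn.
have [t [t2 tD tD12 ot]] := swap_involution cD1 cD2 dD.
have [Q [tQ invQ _]] := IHk D1 cD1.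
have [sQ cQ iQ] := tQ.
have pQ := two_group_on_pgroup tQ.
have tt : t * t = 1 := t2.
have tK x : t (t x) = x by rewrite -permM tt perm1.
have sQt : Q :^ t \subset perm.Sym D2.
  apply/subsetP=> _ /imsetP[q Qq ->]; rewrite inE /perm_on /=.
  apply/subsetP=> x; rewrite inE conjgE !permM; apply: contraR => D2x.
  have tV : t^-1 = t by apply/eqP; rewrite eq_invg_mul tt.
  rewrite tV (out_perm (S := D1) (u := q)) ?tK ?eqxx //.
    by have := subsetP sQ q Qq; rewrite inE.
  by apply: contra D2x => /tD12; rewrite tK.
have tQt : two_group_on D2 (Q :^ t) (2 ^ k - 1) k.
  by split; rewrite ?cardJg // PhiJ indexJg.
have cQQt := Sym_disjoint_cent dD sQ sQt.
have tiQ := Sym_disjoint_TI dD sQ sQt.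
pose B := (Q <*> Q :^ t)%G.
have defB : B :=: Q * Q :^ t by apply: cent_joinEr.
have tB : two_group_on (D1 :|: D2) B (_ + _) (_ + _) := two_group_on_cprod dD tQ tQt.
have [sB cB iB] := tB; have pB := two_group_on_pgroup tB.
have PhiB : 'Phi(B) = 'Phi(Q) * 'Phi(Q :^ t).
  by rewrite defB (Phi_mulg pQ _ cQQt) // pgroupJ.
have QtJ : (Q :^ t) :^ t = Q by rewrite -conjsgM tt conjsg1.
have nBt : t \in 'N(B).
  by rewrite inE /B conjYg QtJ joingC.
have tBn : t \notin B.
  have [x D1x] : exists x, x \in D1 by apply/card_gt0P; rewrite cD1 expn_gt0.
  apply/negP; rewrite defB => /mulsgP[q r Qq Qr tE].
  have := tD12 x D1x; rewrite tE permM; set y := q x.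
  have D1y : y \in D1.
    by rewrite perm_closed //; have := subsetP sQ q Qq; rewrite inE.
  rewrite (out_perm (S := D2) (u := r)) ?(disjointFr dD D1y) //.
  by have := subsetP sQt r Qr; rewrite inE.
have ot2 : #[t] = 2.
  by apply: nt_prime_order => //; apply: contraNneq tBn => ->; apply: group1.
pose G := (B <*> <[t]>)%G.
have defG : G :=: B * <[t]> by apply: norm_joinEr; rewrite cycle_subG.
have tiBt : B :&: <[t]> = 1.
  by rewrite setIC prime_TIg ?cycle_subG // -orderE ot2.
have cG : #|G| = (2 * #|B|)%N by rewrite defG TI_cardMg // -orderE ot2 mulnC.
have pG : 2.-group G.
  by rewrite /pgroup cG cB -expnS pnatX.
have Gt : t \in G by rewrite (subsetP (joing_subr _ _)) // cycle_id.
have sBG : B \subset G := joing_subl _ _.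
have sQB : Q \subset B := joing_subl _ _.
have iBG : #|G : B| = 2 by rewrite -divgS // cG mulnK // cardG_gt0.
have diagB : {in Q, forall q, q * q ^ t \in B}.
  by move=> q Qq; rewrite defB mem_mulg ?memJ_conjg.
have iG : #|G : 'Phi(G)| = (2 ^ k.+1)%N.
  rewrite (index_Phi_wreath pG sBG iBG Gt tBn t2 cQQt tiQ) //.
    by rewrite iQ expnS.
  by rewrite defB.
exists G; split.
- split=> //.
    by rewrite -defD join_subG cycle_subG inE tD andbT.
  rewrite cG cB -expnS (expnS 2 k); congr (2 ^ _)%N.
  by case: (2 ^ k)%N (expn_gt0 2 k) => // q _; rewrite !subn1 mul2n doubleS addnn.
- move=> _; have [k0 | k0] := posnP k; first by exists t; rewrite // ot k0.
  have [s Qs os] := invQ k0; exists s => //.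
  by rewrite (subsetP (subset_trans sQB sBG)).
rewrite ltnS => k0; have [s Qs [s2 os]] := invQ k0.
have oAt : odd_perm t = false by rewrite ot oddX; case: (k) k0.
(* From here on [Q] contains the odd involution [s]; with its conjugate
   [s ^ t] the even part of [B] keeps the Frattini subgroup of [B]. *)
have iBAlt : #|B : B :&: 'Alt_T| = 2.
  exact: index_setI_Alt (subsetP sQB s Qs) os.
have iGAlt : #|G : G :&: 'Alt_T| = 2.
  exact: index_setI_Alt (subsetP (subset_trans sQB sBG) s Qs) os.
have PhiBAlt : 'Phi(B :&: 'Alt_T) = 'Phi(B).
  apply: Phi_setI_Alt_cprod dD tQ tQt _ _; first by exists s.
  by exists (s ^ t); rewrite ?memJ_conjg // -conjXg s2 conj1g odd_permJ.
rewrite (index_Phi_wreath (Q := Q) (B := (B :&: 'Alt_T)%G) (t := t)) //=.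
- by rewrite iQ expnS.
- exact: pgroupS (subsetIl _ _) pG.
- exact: setSI.
- apply/eqP; rewrite -(eqn_pmul2l (cardG_gt0 (B :&: 'Alt_T))) Lagrange ?setSI //.
  rewrite -(eqn_pmul2r (isT : 0 < 2)) -{1}iGAlt Lagrange ?subsetIl //.
  by rewrite cG -(Lagrange (subsetIl B 'Alt_T)) iBAlt mulnC.
- by rewrite inE Gt Alt_even oAt.
- by rewrite inE (negPf tBn).
- by rewrite -defB subsetIl.
- by move=> q Qq; rewrite inE diagB // Alt_even odd_permM odd_permJ addbb.
by rewrite PhiBAlt.
Qed.

Lemma exists_blocks m (k : nat -> nat) D :
    #|D| = (\sum_(i < m) 2 ^ k i)%N ->
  exists G : {group {perm T}},
    two_group_on D G (\sum_(i < m) (2 ^ k i - 1)) (\sum_(i < m) k i)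
    /\ ((exists2 i, i < m & 0 < k i) -> odd_involution_in G).
Proof.
elim: m D => [|m IHm] D.
  rewrite big_ord0 => /cards0_eq->; exists 1%G; split; last by case.
  split; rewrite ?sub1G ?cards1 ?big_ord0 //.
  by rewrite (trivgP (Phi_sub 1%G)) indexgg.
rewrite big_ord_recr /= => cD.
have [D1 [D2 [dD defD cD1 cD2]]] := set_split cD.
have [G1 [tG1 inv1]] := IHm D1 cD1.
have [G2 [tG2 inv2 _]] := exists_block cD2.
exists (G1 <*> G2)%G; split.
  by rewrite !big_ord_recr -defD; apply: two_group_on_cprod.
case=> i lt_im k_gt0; move: lt_im; rewrite ltnS leq_eqVlt => /predU1P[def_i | lt_im].
  have [|s Gs os] := inv2; first by rewrite -def_i.
  by exists s; rewrite // (subsetP (joing_subr _ _)).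
have [|s Gs os] := inv1; first by exists i.
by exists s; rewrite // (subsetP (joing_subl _ _)).
Qed.

(** The order makes [G] a Sylow subgroup of the symmetric group, so its
intersection with the normal subgroup ['Alt_T] is a Sylow subgroup of the latter,
conjugate to [P]. *)
Lemma grank_Sylow_Alt G (P : {group {perm T}}) :
    #|G| = (2 ^ logn 2 #|T|`!)%N -> 2.-Sylow('Alt_T) P ->
  'm(P) = logn 2 #|G :&: 'Alt_T : 'Phi(G :&: 'Alt_T)|.
Proof.
move=> cG sylP.
have sylG : 2.-Sylow('Sym_T) G.
  by rewrite pHallE subsetT cG card_Sym p_part /=.
have sylQ : 2.-Sylow('Alt_T) (G :&: 'Alt_T)%G.
  by apply: Hall_setI_normal sylG; apply: Alt_normal.
have [x _ defQ] := Sylow_trans sylP sylQ.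
rewrite -(grank_Phi (pHall_pgroup sylQ)) [RHS](congr1 (@gen_rank _) defQ).
exact: isog_grank (conj_isog P x).
Qed.

Lemma grank_Sylow_Alt_small (P : {group {perm T}}) :
  #|T| <= 3 -> 2.-Sylow('Alt_T) P -> 'm(P) = 0.
Proof.
move=> leT3 sylP; suffices /card1_trivg->: #|P| = 1%N.
  by apply/eqP; rewrite -leqn0 -gen0 (leq_trans (grank_min _)) ?cards0.
rewrite (card_Hall sylP); have [leT2 | gtT2] := leqP #|T| 2.
  have -> : #|'Alt_T| = 1%N by rewrite (trivial_Alt_2 leT2) cards1.
  by rewrite partn1.
have cT : #|T| = 3 by apply/eqP; rewrite eqn_leq leT3.
suffices -> : #|'Alt_T| = 3 by rewrite p_part lognE.
by apply/eqP; rewrite -(eqn_pmul2l (isT : 0 < 2)) card_Alt cT.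
Qed.

End Permutations.

(** * The 2-adic valuation of a factorial *)

(** Write [a] as [2 ^ e * q] with [q] odd; as [e < k], the odd factor remains
odd when [2 ^ (k - e)] is added to it. *)
Lemma logn2_add k a : 0 < a < (2 ^ k)%N -> logn 2 (2 ^ k + a)%N = logn 2 a.
Proof.
case/andP=> a_gt0 lt_a2k; set e := logn 2 a.
have lt_ek : e < k.
  rewrite -(ltn_exp2l _ _ (isT : 1 < 2)) (leq_ltn_trans _ lt_a2k) //.
  by rewrite dvdn_leq // pfactor_dvdnn.
have [q co_q def_a] := pfactor_coprime (isT : prime 2) a_gt0.
rewrite -/e in def_a.
rewrite def_a -(subnK lt_ek) addnS -addSn expnD -mulnDl lognM ?expn_gt0 //; last first.
  by rewrite addn_gt0 expn_gt0.
rewrite pfactorK // (logn_coprime (m := (2 ^ _ + q)%N)) //.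
by rewrite coprime2n oddD oddX /= -coprime2n.
Qed.

Lemma logn2_factD k a :
  a < (2 ^ k)%N -> logn 2 (2 ^ k + a)`! = (logn 2 (2 ^ k)`! + logn 2 a`!)%N.
Proof.
elim: a => [|a IHa] lt_a; first by rewrite addn0 logn1 addn0.
rewrite addnS !factS !lognM ?fact_gt0 // IHa 1?ltnW // -addnS logn2_add //.
by rewrite addnCA.
Qed.

Lemma logn2_fact_exp k : logn 2 (2 ^ k)`! = (2 ^ k - 1)%N.
Proof.
elim: k => [|k IHk]; first by rewrite logn1.
have p_gt0 : 0 < (2 ^ k)%N by rewrite expn_gt0.
have e : (2 ^ k + (2 ^ k).-1).+1 = (2 ^ k.+1)%N.
  by rewrite -addnS prednK // expnS mul2n addnn.
have e1 : logn 2 (2 ^ k)`! = (k + logn 2 ((2 ^ k).-1)`!)%N.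
  by rewrite -{1}(prednK p_gt0) factS lognM ?fact_gt0 // prednK // pfactorK.
rewrite -{1}e factS lognM ?fact_gt0 // e pfactorK // logn2_factD ?prednK //.
rewrite addnCA addSn -e1 IHk addnS -[RHS]/(_ - 1)%N expnS.
by case: (2 ^ k)%N p_gt0 => // p _; rewrite !subn1 mul2n doubleS addnn.
Qed.

Lemma sum_exp2_lt m (k : nat -> nat) :
    {in gtn m.+1 &, forall i j, i < j -> k i < k j} ->
  \sum_(i < m) (2 ^ k i)%N < (2 ^ k m)%N.
Proof.
elim: m => [|m IHm] hk; first by rewrite big_ord0 expn_gt0.
rewrite big_ord_recr /=; apply: (@leq_trans (2 ^ (k m).+1)).
  rewrite expnS mul2n -addnn ltn_add2r IHm // => i j lti ltj.
  by apply: hk; apply: ltnW.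
by rewrite leq_exp2l // hk // unfold_in /=.
Qed.

Lemma logn2_fact_sum m (k : nat -> nat) :
    {in gtn m &, forall i j, i < j -> k i < k j} ->
  logn 2 (\sum_(i < m) 2 ^ k i)%N`! = (\sum_(i < m) (2 ^ k i - 1))%N.
Proof.
elim: m => [|m IHm] hk; first by rewrite !big_ord0 logn1.
rewrite !big_ord_recr /= addnC logn2_factD ?sum_exp2_lt // logn2_fact_exp addnC.
by rewrite IHm // => i j lti ltj; apply: hk; apply: ltnW.
Qed.

(** * The rank of a Sylow 2-subgroup of the alternating group *)

Local Close Scope group_scope.

Theorem theorem6 (n m : nat) (k : 'I_m.+1 -> nat)
    (hk : forall i j : 'I_m.+1, i < j -> k i < k j)
    (hn : n = \sum_(i < m.+1) 2 ^ k i)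
    (hn2 : n <> 2)
    (hn3 : forall e : nat, 2 <= e -> n <> 2 ^ e + 1)
    (P : {group 'S_n}) (hP : (2.-Sylow('Alt_('I_n)) P)%g)
    (S : {set 'S_n}) (hS : minimal_genset P S) :
  (0 < m -> #|S| = (\sum_(i < m.+1) k i) - 1) /\
  (m = 0 -> #|S| = k ord0).
Proof.
case: hS => _ ->.
(* An extension of [k] to all naturals, so that sums can be cut at [m]. *)
pose h i := k (inord i).
have hE (i : 'I_m.+1) : h i = k i by rewrite /h inord_val.
have h_mono : {in gtn m.+1 &, forall i j, i < j -> h i < h j}.
  by move=> i j lti ltj ltij; apply: hk; rewrite !inordK.
have sumE : n = \sum_(i < m.+1) 2 ^ h i.
  by rewrite hn; apply: eq_bigr => i _; rewrite hE.
have sumkE : \sum_(i < m.+1) k i = \sum_(i < m.+1) h i.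
  by apply: eq_bigr => i _; rewrite hE.
have v2n : logn 2 n`! = \sum_(i < m.+1) (2 ^ h i - 1).
  by rewrite sumE logn2_fact_sum.
split=> [m_gt0 | m0]; last first.
  move: k h hk hn hE h_mono sumE sumkE v2n; rewrite m0 => k h hk hn hE _.
  rewrite !big_ord1 => nE _ v2n; rewrite -(hE ord0) /=.
  have [h0 | h_gt0] := posnP (h 0).
    by rewrite h0 (grank_Sylow_Alt_small _ hP) // card_ord nE h0.
  have h_gt1 : 1 < h 0.
    by rewrite ltn_neqAle h_gt0 andbT; apply/eqP=> h1; apply: hn2; rewrite nE -h1.
  have [|G [[_ cG _] _ iG]] := @exists_block 'I_n (h 0) setT.
    by rewrite cardsT card_ord nE.
  rewrite (grank_Sylow_Alt (G := G)) // ?card_ord ?v2n //.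
  by rewrite iG // pfactorK.
have hm_gt0 : 0 < h m.
  by apply: leq_ltn_trans (h_mono 0 m _ _ m_gt0); rewrite // inE.
(* A second block of size at least 2 besides the last one. *)
have [/existsP[i hi] | /existsPn no_i] := boolP [exists i : 'I_m, 0 < h i].
  have cT : #|[set: 'I_n]| = \sum_(i < m) 2 ^ h i + 2 ^ h m.
    by rewrite cardsT card_ord [LHS]sumE big_ord_recr.
  have [D1 [D2 [dD _ cD1 cD2]]] := set_split cT.
  have [G1 [tG1 inv1]] := exists_blocks cD1.
  have [G2 [tG2 inv2 _]] := exists_block cD2.
  have [_ cG _] := two_group_on_cprod dD tG1 tG2.
  rewrite (grank_Sylow_Alt (G := (G1 <*> G2)%G)) //; last first.
    by rewrite card_ord cG v2n big_ord_recr.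
  rewrite (index_Phi_setI_Alt_cprod dD tG1 tG2); last by apply: inv2.
    by rewrite sumkE big_ord_recr pfactorK.
  by apply: inv1; exists i.
(* Without it [n = 2 ^ h 1 + 1], hence [n = 3] by [hn3]. *)
have m1 : m = 1.
  apply/eqP; rewrite eqn_leq m_gt0 andbT leqNgt; apply/negP=> m_gt1.
  have := no_i (Ordinal m_gt1); rewrite -leqNgt leqn0 /= => /eqP h1.
  have h01 : h 0 < h 1 by apply: h_mono; rewrite // inE ltnS ltnW.
  by rewrite h1 in h01.
move: sumE; rewrite sumkE m1 !big_ord_recr !big_ord0 /= !add0n => nE.
have h0 : h 0 = 0.
  by have := no_i (Ordinal m_gt0); rewrite -leqNgt leqn0 => /eqP.
have h1 : h 1 = 1.
  rewrite m1 in hm_gt0; apply/eqP; rewrite eqn_leq hm_gt0 andbT leqNgt; apply/negP=> /hn3.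
  by apply; rewrite nE h0 addnC.
by rewrite h0 h1 (grank_Sylow_Alt_small _ hP) // card_ord nE h0 h1.
Qed.
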